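(* The composition product $\circ\colon \mathbb{K}^m_{LC}\langle\langle X\rangle\rangle\times\mathbb{K}^m_{LC}\langle\langle X\rangle\rangle\to\mathbb{K}^m_{LC}\langle\langle X\rangle\rangle$ is continuous with respect to the Silva topology.
   Context: $\mathbb{K}\in\{\mathbb{R},\mathbb{C}\}$. $X=\{x_0,x_1,\ldots,x_m\}$ is a finite alphabet, $X^\ast$ its set of words (including the empty word $\emptyset$), $|\eta|$ the length. $\mathbb{K}^m\langle\langle X\rangle\rangle$ is the set of maps $X^\ast\to\mathbb{K}^m$. For $M>0$, $\|c\|_{\ell_\infty,M}=\sup_\eta|(c,\eta)|/(M^{|\eta|}|\eta|!)$ with $|z|=\max_i|z_i|$, and $\ell_{\infty,M}(X^\ast,\mathbb{K}^m)$ is the Banach space of series with finite norm. $\mathbb{K}^m_{LC}\langle\langle X\rangle\rangle=\bigcup_{M>0}\ell_{\infty,M}(X^\ast,\mathbb{K}^m)$ with the Silva topology, i.e. the locally convex inductive limit topology of these Banach spaces. The shuffle product $\sqcup\!\sqcup$ is the bilinear product determined on words by $(x_i\eta)\sqcup\!\sqcup(x_j\xi)=x_i(\eta\sqcup\!\sqcup(x_j\xi))+x_j((x_i\eta)\sqcup\!\sqcup\xi)$, $\eta\sqcup\!\sqcup\emptyset=\emptyset\sqcup\!\sqcup\eta=\eta$. Composition product: for $c,d$ with $d$ having components $d[1],\ldots,d[m]$ and $d[0]:=\mathbf{1}=1\cdot\emptyset$, let $\psi_d(\emptyset)=\mathrm{id}$, $\psi_d(x_i\eta)=\psi_d(x_i)\circ\psi_d(\eta)$,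 $\psi_d(x_i)(e)=x_0(d[i]\sqcup\!\sqcup e)$ for $e\in\mathbb{K}\langle\langle X\rangle\rangle$; then $c\circ d=\sum_{\eta\in X^\ast}(c,\eta)\,\psi_d(\eta)(\mathbf{1})$. *)

(* Defs.v *)
From mathcomp Require Import all_boot all_order all_algebra.
From mathcomp Require Import reals complex.
Set Implicit Arguments. Unset Strict Implicit. Unset Printing Implicit Defensive.
Import Order.TTheory GRing.Theory Num.Theory.
Local Open Scope ring_scope.

Section Series.
Variable K : numFieldType.
Variable m : nat.

Definition word := seq 'I_m.+1.

Definition sseries := word -> K.
Definition series := word -> 'I_m -> K.

(* Shuffle of two words, as the list of words (with multiplicity):
   (x_i u) sh (x_j v) = x_i (u sh x_j v) + x_j (x_i u sh v), u sh [] = [] sh u = u. *)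
Fixpoint shw (u v : word) : seq word :=
  match u with
  | [::] => [:: v]
  | a :: u' =>
      let fix g (v : word) : seq word :=
        match v with
        | [::] => [:: a :: u']
        | b :: v' => map (cons a) (shw u' v) ++ map (cons b) (g v')
        end in g v
  end.

(* Bilinear extension of the shuffle to scalar series.  The coefficient of nu
   only receives contributions from pairs (eta, xi) with |eta| + |xi| = |nu|. *)
Definition shuffle (e f : sseries) : sseries := fun nu =>
  \sum_(k < (size nu).+1) \sum_(eta : k.-tuple 'I_m.+1)
     \sum_(xi : (size nu - k).-tuple 'I_m.+1)
        e eta * f xi * (count_mem nu (shw eta xi))%:R.

Definition one_series : sseries := fun nu => if nu is [::] then 1 else 0.

Definition x0_cat (e : sseries) : sseries := fun nu =>
  match nu with
  | a :: nu' => if a == ord0 then e nu' else 0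
  | [::] => 0
  end.

Definition dcomp (d : series) (i : 'I_m.+1) : sseries :=
  match unlift ord0 i with
  | None => one_series
  | Some j => fun w => d w j
  end.

Definition psi (d : series) (eta : word) (e : sseries) : sseries :=
  foldr (fun i acc => x0_cat (shuffle (dcomp d i) acc)) e eta.

(* c o d = sum_eta (c, eta) psi_d(eta)(1).  Since psi_d(eta)(1) is supported on
   words of length >= |eta|, the coefficient at nu is the finite sum over
   |eta| <= |nu|. *)
Definition comp (c d : series) : series := fun nu j =>
  \sum_(k < (size nu).+1) \sum_(eta : k.-tuple 'I_m.+1)
     c eta j * psi d eta one_series nu.

Definition sadd (c d : series) : series := fun w j => c w j + d w j.
Definition ssub (c d : series) : series := fun w j => c w j - d w j.
Definition sscale (a : K) (c : series) : series := fun w j => a * c w j.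

(* B bounds the weighted coefficients: |(c,w)| <= B M^|w| |w|! (with |z| the
   max norm on K^m).  Hence c in l_{infty,M} iff some B works, and
   ||c||_{l_infty,M} is the least such B. *)
Definition wbound (M B : K) (c : series) : Prop :=
  forall (w : word) (j : 'I_m), `|c w j| <= B * M ^+ size w * (size w)`!%:R.

Definition in_linf (M : K) (c : series) : Prop := exists B, wbound M B c.

Definition LC (c : series) : Prop := exists M, 0 < M /\ in_linf M c.

Definition seminorm_LC (p : series -> K) : Prop :=
  (forall c, LC c -> 0 <= p c) /\
  (forall c d, LC c -> LC d -> p (sadd c d) <= p c + p d) /\
  (forall a c, LC c -> p (sscale a c) = `|a| * p c).

(* A seminorm is continuous for the Silva (locally convex inductive limit)
   topology iff its restriction to every Banach space l_{infty,M} is continuous,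
   i.e. bounded by a constant times ||.||_{l_infty,M}. *)
Definition silva_seminorm (p : series -> K) : Prop :=
  seminorm_LC p /\
  forall M, 0 < M -> exists C, 0 <= C /\
    forall c B, 0 <= B -> wbound M B c -> p c <= C * B.

(* Open sets of the Silva topology: the locally convex topology on LC
   generated by all such seminorms (a directed family, so single seminorm
   balls form a neighbourhood base). *)
Definition silva_open (U : series -> Prop) : Prop :=
  (forall c, U c -> LC c) /\
  forall c, U c -> exists p, silva_seminorm p /\ exists eps, 0 < eps /\
    forall d, LC d -> p (ssub d c) < eps -> U d.

Definition silva_open2 (W : series -> series -> Prop) : Prop :=
  (forall c d, W c d -> LC c /\ LC d) /\
  forall c d, W c d -> exists U V, silva_open U /\ silva_open V /\ U c /\ V d /\
    forall c' d', U c' -> V d' -> W c' d'.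

Definition comp_silva_continuous : Prop :=
  (forall c d, LC c -> LC d -> LC (comp c d)) /\
  forall U, silva_open U ->
    silva_open2 (fun c d => LC c /\ LC d /\ U (comp c d)).

End Series.

(* Main.v *)
(* The coefficient of [c o d] at a word of length n only involves coefficients of
   c and d at words of length at most n, and the composition is Lipschitz on such
   truncations: if c, c0, d, d0 lie in a fixed ball of l_{infty,M} and
   c - c0, d - d0 have norm at most eps there, then the coefficients of
   [c o d - c0 o d0] are at most [eps D G^n n!] with D, G depending only on the ball.
   A neighbourhood of 0 in the Silva topology is given by [|(h, w)| < delta r(|w|)^|w| |w|!]
   with r nondecreasing and unbounded.  On words of length at most n such an h behaves like
   an element of l_{infty,r(n)}, so the estimate applies with the radius r(n); letting r
   grow slowly enough, the homogeneous part of degree n of [c o d - c0 o d0] has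
   p-seminorm at most [eps / 2^(n+2)], and these parts can be summed because the
   tails of a series in l_{infty,M} tend to 0 in l_{infty,2M}. *)
Require Import Defs.
From mathcomp Require Import all_boot all_order all_algebra.
From mathcomp Require Import reals complex.
From mathcomp Require Import boolp zify ring.
Set Implicit Arguments. Unset Strict Implicit. Unset Printing Implicit Defensive.
Import Order.TTheory GRing.Theory Num.Theory.

(** * Sums over tuples and the multiplicity of a word in shuffles *)

Lemma big_tuple_cons (T : finType) (R : Type) (idx : R)
    (op : Monoid.com_law idx) (k : nat) (F : seq T -> R) :
  \big[op/idx]_(t : k.+1.-tuple T) F t =
  \big[op/idx]_(a : T) \big[op/idx]_(t : k.-tuple T) F (a :: t).
Proof.
rewrite pair_big /=.
rewrite (reindex (fun p : T * k.-tuple T => [tuple of p.1 :: p.2])) //=.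
exists (fun t : k.+1.-tuple T => (thead t, [tuple of behead t])) => [[a t] _|t _] /=.
  by congr pair; apply: val_inj.
by rewrite [RHS]tuple_eta; apply: val_inj.
Qed.

Lemma big_tuple0 (T : finType) (R : Type) (idx : R)
    (op : Monoid.com_law idx) (F : seq T -> R) :
  \big[op/idx]_(t : 0.-tuple T) F t = F [::].
Proof.
rewrite (big_pred1 [tuple]) // => t.
by rewrite (tuple0 t) /= eqxx.
Qed.

Lemma count_map_cons (T : eqType) (a b : T) (nu : seq T) (s : seq (seq T)) :
  count_mem (b :: nu) (map (cons a) s) = ((a == b) * count_mem nu s)%N.
Proof.
rewrite count_map; case: eqVneq => [->|ne] /=.
  by rewrite mul1n; apply: eq_count => w /=; rewrite eqseq_cons eqxx.
by rewrite mul0n -(count_pred0 s); apply: eq_count => w /=; rewrite eqseq_cons (negbTE ne).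
Qed.

Lemma shw_nil (m : nat) (u : word m) : shw u [::] = [:: u].
Proof. by case: u. Qed.

Lemma shw_cons (m : nat) (a b : 'I_m.+1) (u v : word m) :
  shw (a :: u) (b :: v) = map (cons a) (shw u (b :: v)) ++ map (cons b) (shw (a :: u) v).
Proof. by []. Qed.

Lemma sum_tuple_pred1 (T : finType) (w : seq T) :
  (\sum_(t : (size w).-tuple T) count_mem w [:: tval t] = 1)%N.
Proof.
rewrite (bigD1 (in_tuple w)) //= eqxx big1 // => t ne.
by rewrite addn0; case: eqP => // e; rewrite -val_eqE /= e eqxx in ne.
Qed.

(** A word of length [k + l] arises from a shuffle by choosing which [k] of its positions come from
    [eta]; the chosen positions then determine [eta] and [xi]. Formally, induction on [nu] gives
    Pascal's rule. *)
Lemma sum_count_shw (m k l : nat) (nu : word m) : size nu = (k + l)%N ->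
  (\sum_(eta : k.-tuple 'I_m.+1) \sum_(xi : l.-tuple 'I_m.+1)
     count_mem nu (shw eta xi) = 'C(k + l, k))%N.
Proof.
elim: nu k l => [|a nu IH] [|k] [|l] //= sz.
- rewrite (big_tuple0 _ (fun t => \sum_(xi : 0.-tuple 'I_m.+1) count_mem [::] (shw t xi))%N).
  by rewrite (big_tuple0 _ (fun xi => count_mem [::] (shw [::] xi))).
- rewrite (big_tuple0 _ (fun t => \sum_(xi : l.+1.-tuple 'I_m.+1) count_mem (a :: nu) (shw t xi))%N) bin0.
  by rewrite -[RHS](sum_tuple_pred1 (a :: nu)) /= sz.
- rewrite (eq_bigr (fun t : k.+1.-tuple 'I_m.+1 => count_mem (a :: nu) [:: tval t])); last first.
    by move=> t _; rewrite (big_tuple0 addn (fun xi => count_mem (a :: nu) (shw (tval t) xi))) shw_nil.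
  rewrite addn0 binn -[RHS](sum_tuple_pred1 (a :: nu)) /=.
  by move: sz; rewrite addn0 => ->.
rewrite (big_tuple_cons _ _ (fun t => \sum_(xi : l.+1.-tuple 'I_m.+1) count_mem (a :: nu) (shw t xi))%N).
(* The leading letter [a] of [nu] is taken either from the first word or from the second. *)
have -> : (\sum_(b : 'I_m.+1) \sum_(t : k.-tuple 'I_m.+1) \sum_(xi : l.+1.-tuple 'I_m.+1)
    count_mem (a :: nu) (shw (b :: t) xi) =
   \sum_(b : 'I_m.+1) \sum_(t : k.-tuple 'I_m.+1) \sum_(xi : l.+1.-tuple 'I_m.+1)
     (b == a) * count_mem nu (shw t xi) +
   \sum_(b : 'I_m.+1) \sum_(t : k.-tuple 'I_m.+1) \sum_(c : 'I_m.+1) \sum_(xi : l.-tuple 'I_m.+1)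
     (c == a) * count_mem nu (shw (b :: t) xi))%N.
  rewrite -big_split; apply: eq_bigr => b _; rewrite -big_split; apply: eq_bigr => t _ /=.
  rewrite !(big_tuple_cons _ _ (fun xi => count_mem (a :: nu) (shw (b :: t) xi))).
  rewrite (big_tuple_cons _ _ (fun xi => (b == a) * count_mem nu (shw t xi))%N) -big_split.
  apply: eq_bigr => c _; rewrite -big_split; apply: eq_bigr => xi _.
  by rewrite shw_cons count_cat !count_map_cons.
rewrite (bigD1 a) //= [X in (_ + X + _)%N]big1 ?addn0; last first.
  by move=> b /negbTE ne; rewrite big1 // => t _; rewrite big1 // => xi _; rewrite ne.
rewrite eqxx.
under eq_bigr => t _ do under eq_bigr => xi _ do rewrite mul1n.
rewrite IH; last by move: sz; lia.
have -> : (\sum_(b : 'I_m.+1) \sum_(t : k.-tuple 'I_m.+1) \sum_(c : 'I_m.+1) \sum_(xi : l.-tuple 'I_m.+1)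
     (c == a) * count_mem nu (shw (b :: t) xi) =
  \sum_(t : k.+1.-tuple 'I_m.+1)  \sum_(xi : l.-tuple 'I_m.+1) count_mem nu (shw t xi))%N.
  rewrite (big_tuple_cons _ _ (fun t => \sum_(xi : l.-tuple 'I_m.+1) count_mem nu (shw t xi))%N).
  apply: eq_bigr => b _; apply: eq_bigr => t _.
  rewrite (bigD1 a) //= [X in (_ + X)%N]big1 ?addn0; last first.
    by move=> c /negbTE ne; rewrite big1 // => xi _; rewrite ne.
  by rewrite eqxx; apply: eq_bigr => xi _; rewrite mul1n.
rewrite IH; last by move: sz; lia.
by rewrite [in RHS]addSn binS addSnnS addnC.
Qed.

(** * Coefficient estimates for shuffles and for prefixing by x_0 *)

Section Estimates.
Variables (K : numFieldType) (m : nat).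
Local Open Scope ring_scope.
Implicit Types (c d : series K m) (e f g : sseries K m) (w nu : word m).

(** Once the bounds depend on lengths only, [sum_count_shw] collapses the sums over words, and the
    shuffle becomes a binomial convolution in the length. *)
Lemma shuffle_bound e f (E F : nat -> K) nu :
    (forall w, (size w <= size nu)%N -> `|e w| <= E (size w)) ->
    (forall w, (size w <= size nu)%N -> `|f w| <= F (size w)) ->
  `|shuffle e f nu| <=
    \sum_(k < (size nu).+1) E k * F (size nu - k)%N * 'C(size nu, k)%:R.
Proof.
move=> He Hf; rewrite /shuffle.
apply: le_trans (ler_norm_sum _ _ _) _; apply: ler_sum => k _.
have lk : (k <= size nu)%N by rewrite -ltnS.
rewrite -[X in 'C(X, k)](subnKC lk) -(@sum_count_shw m _ _ nu) ?subnKC //.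
rewrite natr_sum mulr_sumr.
apply: le_trans (ler_norm_sum _ _ _) _; apply: ler_sum => eta _.
rewrite natr_sum mulr_sumr.
apply: le_trans (ler_norm_sum _ _ _) _; apply: ler_sum => xi _.
rewrite !normrM normr_nat; apply: ler_wpM2r => //.
apply: ler_pM => //.
  by apply: le_trans (He _ _) _; rewrite size_tuple.
by apply: le_trans (Hf _ _) _; rewrite size_tuple // leq_subr.
Qed.

Lemma shuffle_support e f k nu : (size nu < k)%N ->
  (forall w, (size w < k)%N -> f w = 0) -> shuffle e f nu = 0.
Proof.
move=> ltk f0; rewrite /shuffle big1 // => i _; rewrite big1 // => eta _.
rewrite big1 // => xi _; rewrite f0 ?mulr0 ?mul0r // size_tuple.
by apply: leq_ltn_trans ltk; rewrite leq_subr.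
Qed.

Lemma shuffleB e e0 f f0 nu :
  shuffle e f nu - shuffle e0 f0 nu =
  shuffle (fun w => e w - e0 w) f nu + shuffle e0 (fun w => f w - f0 w) nu.
Proof.
rewrite /shuffle -sumrB -big_split; apply: eq_bigr => k _ /=.
rewrite -sumrB -big_split; apply: eq_bigr => eta _ /=.
rewrite -sumrB -big_split; apply: eq_bigr => xi _ /=.
ring.
Qed.

Lemma x0_cat_support e k nu : (size nu <= k)%N ->
  (forall w, (size w < k)%N -> e w = 0) -> x0_cat e nu = 0.
Proof. by case: nu => //= a nu lt e0; case: ifP => // _; apply: e0. Qed.

(** This geometric sum appears when a series of radius [M] is shuffled with one of radius [2 * M];
    the letter x_0 prefixed afterwards raises the length to [n.+1] and so pays for the bound. *)
Lemma sum_geo_le n : (\sum_(i < n.+1) 2 ^ (n - i) <= 2 ^ n.+1)%N.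
Proof.
rewrite (reindex_inj rev_ord_inj) /=.
under eq_bigr => i _ do rewrite subSS subKn -1?ltnS //.
elim: n => [|n IH]; first by rewrite big_ord1.
by rewrite big_ord_recr /= [X in (_ <= X)%N]expnS; move: IH; lia.
Qed.

(* The factor [k!] records the gain of the iterated integrals
   [x_0 (g sh -)]; it will absorb the [|eta|!] allowed in [(c, eta)]. *)
Lemma x0_shuffle_bound (N k M : nat) (A b : K) g f :
    (0 < M)%N -> 0 <= A -> 0 <= b ->
    (forall w, (size w <= N)%N -> `|g w| <= b * (M ^ size w * (size w)`!)%:R) ->
    (forall w, (size w <= N)%N ->
       `|f w| * k`!%:R <= A * ((2 * M) ^ size w * (size w)`!)%:R) ->
    (forall w, (size w < k)%N -> f w = 0) ->
  forall w, (size w <= N)%N ->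
  `|x0_cat (shuffle g f) w| * k.+1`!%:R
     <= b * A * ((2 * M) ^ size w * (size w)`!)%:R.
Proof.
move=> M0 A0 b0 Hg Hf f0 [|a w] lw /=; first by rewrite normr0 mul0r !mulr_ge0.
case: ifP => _; last by rewrite normr0 mul0r !mulr_ge0.
have kf : k`!%:R != 0 :> K by rewrite pnatr_eq0 -lt0n fact_gt0.
have kp : 0 < k`!%:R :> K by rewrite ltr0n fact_gt0.
(* The support condition leaves only [k <= size w], so the new factor [k.+1] is absorbed by passing
   from the factorial of [size w] to that of [(size w).+1]. *)
have [ltk|lek] := ltnP (size w) k.
  by rewrite (shuffle_support _ ltk f0) normr0 mul0r !mulr_ge0.
have H := @shuffle_bound g f (fun n => b * (M ^ n * n`!)%:R)
  (fun n => A * ((2 * M) ^ n * n`!)%:R / k`!%:R) w.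
have {}H : `|shuffle g f w| <= \sum_(i < (size w).+1)
   b * (M ^ i * i`!)%:R * (A * ((2 * M) ^ (size w - i) * (size w - i)`!)%:R / k`!%:R) *
   'C(size w, i)%:R.
  apply: H => v lv; first by apply: Hg; apply: leq_trans lv (ltnW lw).
  by rewrite ler_pdivlMr //; apply: Hf; apply: leq_trans lv (ltnW lw).
set n := size w in lek H *.
have E : \sum_(i < n.+1)
   b * (M ^ i * i`!)%:R * (A * ((2 * M) ^ (n - i) * (n - i)`!)%:R / k`!%:R) *
   'C(n, i)%:R = b * A / k`!%:R * (n`! * M ^ n * \sum_(i < n.+1) 2 ^ (n - i))%:R.
  rewrite natrM natr_sum !mulr_sumr; apply: eq_bigr => i _.
  have li : (i <= n)%N by rewrite -ltnS.
  have -> : (n`! * M ^ n = 'C(n, i) * (i`! * (n - i)`!) * (M ^ i * M ^ (n - i)))%N.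
    by rewrite bin_fact // -expnD subnKC.
  by rewrite expnMn !natrM; ring.
rewrite E in H.
apply: le_trans (ler_wpM2r _ H) _ => //.
have -> : k.+1`!%:R = k.+1%:R * k`!%:R :> K by rewrite factS natrM.
have -> : b * A / k`!%:R * (n`! * M ^ n * \sum_(i < n.+1) 2 ^ (n - i))%:R *
   (k.+1%:R * k`!%:R) =
   b * A * (k.+1 * n`! * M ^ n * \sum_(i < n.+1) 2 ^ (n - i))%:R.
  by rewrite !natrM; field.
apply: ler_wpM2l; first exact: mulr_ge0.
rewrite ler_nat factS expnMn [(M ^ n.+1)%N]expnS.
have h1 := sum_geo_le n.
apply: (@leq_trans (n.+1 * n`! * M ^ n * 2 ^ n.+1)).
  by apply: leq_mul h1; rewrite !leq_mul.
have -> : (2 ^ n.+1 * (M * M ^ n) * (n.+1 * n`!) = M * (n.+1 * n`! * M ^ n * 2 ^ n.+1))%N.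
  by ring.
exact: leq_pmull.
Qed.

End Estimates.

(** * Lipschitz estimates for [psi] and for the composition product *)

Section Lipschitz.
Variables (K : numFieldType) (m : nat).
Local Open Scope ring_scope.
Implicit Types (c d : series K m) (e f g : sseries K m) (w nu : word m).

Lemma psi_support d eta nu : (size nu < size eta)%N -> psi d eta (one_series K (m:=m)) nu = 0.
Proof.
elim: eta nu => [|i eta IH] nu //= lt.
apply: (@x0_cat_support _ _ _ (size eta)) => // w lw.
exact: (shuffle_support _ lw).
Qed.

Lemma dcomp_bound (N M B : nat) d : (0 < B)%N ->
    (forall w j, (size w <= N)%N -> `|d w j| <= (B * M ^ size w * (size w)`!)%:R) ->
  forall i w, (size w <= N)%N ->
    `|dcomp d i w| <= B%:R * (M ^ size w * (size w)`!)%:R.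
Proof.
move=> B0 Hd i w lw; rewrite /dcomp; case: unliftP => [j|] _.
  by rewrite -natrM mulnA Hd.
case: w lw => [|a w] _ /=; last by rewrite normr0 mulr_ge0.
by rewrite normr1 mulr1 ler1n.
Qed.

(** Iterates [x0_shuffle_bound]: each letter costs one factor [B], while the radius stays at [2 * M]
    instead of doubling again. *)
Lemma psi_bound (N M B : nat) d : (0 < B)%N -> (0 < M)%N ->
    (forall w j, (size w <= N)%N -> `|d w j| <= (B * M ^ size w * (size w)`!)%:R) ->
  forall eta w, (size w <= N)%N ->
  `|psi d eta (one_series K (m:=m)) w| * (size eta)`!%:R <=
    (B ^ size eta)%:R * ((2 * M) ^ size w * (size w)`!)%:R.
Proof.
move=> B0 M0 Hd; elim=> [|i eta IH] w lw.
  case: w lw => [|a w] _ /=; last by rewrite normr0 mul0r mulr_ge0.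
  by rewrite normr1.
rewrite [psi _ _ _]/= [size (i :: eta)]/= expnS natrM.
apply: (@x0_shuffle_bound _ _ N _ M) => //.
  exact: dcomp_bound.
by move=> v lv; apply: psi_support.
Qed.

(** Changing [d] into [d0] one letter at a time costs [eps] per letter, whence the factor
    [size eta]. *)
Lemma psi_lipschitz (N M B : nat) (eps : K) d d0 : (0 < B)%N -> (0 < M)%N -> 0 <= eps ->
    (forall w j, (size w <= N)%N -> `|d w j| <= (B * M ^ size w * (size w)`!)%:R) ->
    (forall w j, (size w <= N)%N -> `|d0 w j| <= (B * M ^ size w * (size w)`!)%:R) ->
    (forall w j, (size w <= N)%N ->
       `|d w j - d0 w j| <= eps * (B * M ^ size w * (size w)`!)%:R) ->
  forall eta w, (size w <= N)%N ->
  `|psi d eta (one_series K (m:=m)) w - psi d0 eta (one_series K (m:=m)) w|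
     * (size eta)`!%:R <=
    eps * (size eta * B ^ size eta)%:R * ((2 * M) ^ size w * (size w)`!)%:R.
Proof.
move=> B0 M0 e0 Hd Hd0 Hdd; elim=> [|i eta IH] w lw.
  by rewrite subrr normr0 mul0r !mulr_ge0.
rewrite [size (i :: eta)]/=.
set f := psi d eta (one_series K (m:=m)) in IH *.
set f0 := psi d0 eta (one_series K (m:=m)) in IH *.
have -> : psi d (i :: eta) (one_series K (m:=m)) w - psi d0 (i :: eta) (one_series K (m:=m)) w =
   x0_cat (shuffle (fun v => dcomp d i v - dcomp d0 i v) f) w +
   x0_cat (shuffle (dcomp d0 i) (fun v => f v - f0 v)) w.
  case: w {lw} => [|a w] /=; first by rewrite subrr addr0.
  by case: ifP => _; [exact: shuffleB | rewrite subrr addr0].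
apply: le_trans (ler_wpM2r _ (ler_normD _ _)) _ => //; rewrite mulrDl.
have h1 : `|x0_cat (shuffle (fun v => dcomp d i v - dcomp d0 i v) f) w| * (size eta).+1`!%:R
   <= (eps * B%:R) * (B ^ size eta)%:R * ((2 * M) ^ size w * (size w)`!)%:R.
  apply: (@x0_shuffle_bound _ _ N _ M) => //; first exact: mulr_ge0.
  - move=> v lv; rewrite /dcomp; case: unliftP => [j|] _.
      by rewrite -mulrA -natrM mulnA Hdd.
    by rewrite subrr normr0 !mulr_ge0.
  - exact: psi_bound.
  - by move=> v lv; apply: psi_support.
have h2 : `|x0_cat (shuffle (dcomp d0 i) (fun v => f v - f0 v)) w| * (size eta).+1`!%:R
   <= B%:R * (eps * (size eta * B ^ size eta)%:R) * ((2 * M) ^ size w * (size w)`!)%:R.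
  apply: (@x0_shuffle_bound _ _ N _ M) => //; first exact: mulr_ge0.
  - exact: dcomp_bound.
  - by move=> v lv; rewrite /f /f0 !psi_support // subrr.
apply: le_trans (lerD h1 h2) _.
have -> : ((size eta).+1 * B ^ (size eta).+1 = B * B ^ size eta + B * (size eta * B ^ size eta))%N.
  by rewrite expnS; ring.
rewrite natrD !natrM le_eqVlt; apply/orP; left; apply/eqP; ring.
Qed.

(** The factorial allowed in the coefficients at [eta] cancels the one gained by [psi]. The constant
    8 is a product of three factors 2: the radius [2 * M], the weight [k.+1 <= 2 ^ n], and the
    [n.+1 <= 2 ^ n] lengths summed over. *)
Lemma comp_lipschitz (N M B : nat) (eps : K) c c0 d d0 :
    (0 < B)%N -> (0 < M)%N -> 0 <= eps ->
    (forall w j, (size w <= N)%N -> `|c0 w j| <= (B * M ^ size w * (size w)`!)%:R) ->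
    (forall w j, (size w <= N)%N -> `|d w j| <= (B * M ^ size w * (size w)`!)%:R) ->
    (forall w j, (size w <= N)%N -> `|d0 w j| <= (B * M ^ size w * (size w)`!)%:R) ->
    (forall w j, (size w <= N)%N ->
       `|c w j - c0 w j| <= eps * (B * M ^ size w * (size w)`!)%:R) ->
    (forall w j, (size w <= N)%N ->
       `|d w j - d0 w j| <= eps * (B * M ^ size w * (size w)`!)%:R) ->
  forall w j, (size w <= N)%N ->
  `|Defs.comp c d w j - Defs.comp c0 d0 w j| <=
    eps * (B * (8 * M * (m.+1 * M * B)) ^ size w * (size w)`!)%:R.
Proof.
move=> B0 M0 e0 Hc0 Hd Hd0 Hcc Hdd w j lw; set n := size w.
pose Y := ((2 * M) ^ n * n`!)%N.
have term k (eta : k.-tuple 'I_m.+1) : (k <= n)%N ->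
   `|c eta j * psi d eta (one_series K (m:=m)) w
     - c0 eta j * psi d0 eta (one_series K (m:=m)) w|
     <= eps * (B * k.+1 * (M * B) ^ k * Y)%:R.
  move=> lk.
  set f := psi d eta _ w; set f0 := psi d0 eta _ w.
  have -> : c eta j * f - c0 eta j * f0 = (c eta j - c0 eta j) * f + c0 eta j * (f - f0) by ring.
  have kp : 0 < k`!%:R :> K by rewrite ltr0n fact_gt0.
  have kf : k`!%:R != 0 :> K by rewrite gt_eqF.
  have sk : size eta = k by rewrite size_tuple.
  have sN : (size eta <= N)%N by rewrite sk (leq_trans lk).
  have Hf : `|f| <= (B ^ k * Y)%:R / k`!%:R.
    by rewrite ler_pdivlMr // -sk natrM; apply: (@psi_bound N).
  have Hff : `|f - f0| <= eps * (k * B ^ k * Y)%:R / k`!%:R.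
    by rewrite ler_pdivlMr // -sk natrM mulrA; apply: (@psi_lipschitz N).
  apply: le_trans (ler_normD _ _) _; rewrite !normrM.
  apply: le_trans (lerD (ler_pM _ _ (Hcc _ _ sN) Hf) (ler_pM _ _ (Hc0 _ _ sN) Hff)) _ => //.
  rewrite sk le_eqVlt; apply/orP; left; apply/eqP.
  have -> : (B * k.+1 * (M * B) ^ k * Y = B * M ^ k * B ^ k * Y + B * M ^ k * k * B ^ k * Y)%N.
    by rewrite expnMn; ring.
  by rewrite natrD !natrM; field.
rewrite /Defs.comp -sumrB.
apply: le_trans (ler_norm_sum _ _ _) _.
(* The factor [m.+1 ^ k] counts the words of length [k]. *)
apply: (@le_trans _ _ (\sum_(k < n.+1) eps * (m.+1 ^ k * (B * k.+1 * (M * B) ^ k * Y))%:R)).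
  apply: ler_sum => k _; rewrite -sumrB.
  apply: le_trans (ler_norm_sum _ _ _) _.
  apply: le_trans (ler_sum _ _) _.
    by move=> eta _; apply: term; rewrite -ltnS.
  by rewrite sumr_const card_tuple card_ord [X in _ <= _ * X]natrM [X in _ <= _ * X]mulrC mulrA [X in _ <= X]mulr_natr.
rewrite -mulr_sumr -natr_sum; apply: ler_wpM2l => //; rewrite ler_nat.
have h k : (k <= n)%N ->
  (m.+1 ^ k * (B * k.+1 * (M * B) ^ k * Y) <= 2 ^ n * (B * (m.+1 * M * B) ^ n * Y))%N.
  move=> lk.
  have -> : (m.+1 ^ k * (B * k.+1 * (M * B) ^ k * Y) = k.+1 * (B * (m.+1 * M * B) ^ k * Y))%N.
    by rewrite -[(m.+1 * M * B)%N]mulnA [in RHS]expnMn; ring.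
  rewrite !leq_mul //.
    by apply: leq_trans (ltn_expl k (ltnSn 1)) _; rewrite leq_exp2l.
  by rewrite leq_pexp2l // !muln_gt0 M0 B0.
apply: (@leq_trans (\sum_(k < n.+1) 2 ^ n * (B * (m.+1 * M * B) ^ n * Y))).
  by apply: leq_sum => k _; apply: h; rewrite -ltnS.
rewrite sum_nat_const card_ord.
apply: (@leq_trans (2 ^ n * (2 ^ n * (B * (m.+1 * M * B) ^ n * Y)))).
  by rewrite leq_mul // ltn_expl.
rewrite /Y (_ : 8 = 2 * (2 * 2))%N // !expnMn leq_eqVlt; apply/orP; left; apply/eqP; ring.
Qed.

End Lipschitz.

(** * Radii growing slowly enough to respect given thresholds *)

Lemma leq_wexp2r (a b n : nat) : (a <= b -> a ^ n <= b ^ n)%N.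
Proof. by case: n => // n le; rewrite leq_exp2r. Qed.

Lemma slow_growth (thr : nat -> nat) : exists r : nat -> nat,
  [/\ forall n, (0 < r n)%N, {homo r : a b / (a <= b)%N},
      forall R, exists n0, forall n, (n0 <= n)%N -> (R <= r n)%N &
      forall n, r n = 1%N \/ (thr (r n) <= n)%N].
Proof.
pose r := fix r n := if n is n'.+1 then
  (if (thr (r n').+1 <= n)%N then (r n').+1 else r n') else 1%N.
have rS n : r n.+1 = if (thr (r n).+1 <= n.+1)%N then (r n).+1 else r n by [].
have rmono : {homo r : a b / (a <= b)%N}.
  apply: homo_leq => // [|n]; first exact: leq_trans.
  by rewrite rS; case: ifP.
exists r; split=> //.
- by move=> n; apply: (rmono 0%N).
- move=> R; suff [n0 h] : exists n0, (R <= r n0)%N.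
    by exists n0 => n /rmono; apply: leq_trans.
  elim: R => [|R [n0 IH]]; first by exists 0%N.
  (* At this degree [R] has been attained and the threshold of [R.+1] is met, so the next step must
     increase [r] if it still equals [R]. *)
  pose n := maxn n0 (thr R.+1).
  have [lt|le] := ltnP R (r n); first by exists n.
  have e : r n = R.
    by apply/eqP; rewrite eqn_leq le (leq_trans IH) // rmono // leq_maxl.
  exists n.+1; rewrite rS e ifT //.
  by rewrite (leq_trans _ (leqnSn _)) // leq_maxr.
- elim=> [|n IH]; first by left.
  rewrite rS; case: ifP => [h|_]; first by right.
  by case: IH => [->|h]; [left | right; apply: leq_trans h _].
Qed.

(** * Silva seminorms and continuity of the composition product *)

Section Silva.
Variables (K : numFieldType) (m : nat).
Local Open Scope ring_scope.
Implicit Types (c d e f : series K m) (w : word m) (p q : series K m -> K).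

(* The two properties of the order shared by R and C that are needed; in C, where
   [0 <= x] forces x to be real, they are inherited from R. *)
Hypothesis archK : forall x : K, 0 <= x -> exists n : nat, x <= n%:R.
Hypothesis lubK : forall (A : K -> Prop) (b : K), A 0 ->
  (forall x, A x -> 0 <= x <= b) ->
  exists s, (forall x, A x -> x <= s) /\
    forall b', (forall x, A x -> x <= b') -> s <= b'.

(** Variant of [wbound] with natural constants, so that the bookkeeping of constants takes place in
    [nat]. *)
Definition gbound (B M : nat) c :=
  forall w j, `|c w j| <= (B * M ^ size w * (size w)`!)%:R.

Lemma gboundW B M B' M' c : (B <= B')%N -> (M <= M')%N ->
  gbound B M c -> gbound B' M' c.
Proof.
move=> lB lM h w j; apply: le_trans (h w j) _; rewrite ler_nat.
by rewrite !leq_mul // leq_wexp2r.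
Qed.

Lemma LCP c : LC c <-> exists B M : nat, [/\ (0 < B)%N, (0 < M)%N & gbound B M c].
Proof.
split=> [[M [M0 [B h]]]|[B [M [B0 M0 h]]]]; last first.
  by exists M%:R; rewrite ltr0n; split=> //; exists B%:R => w j; rewrite -natrX -!natrM.
have [M' hM] := archK (ltW M0).
(* The norm is taken because nothing forces [B] to be nonnegative until an index [j] is at hand; for
   [m = 0] there is none. *)
have [B' hB] := archK (normr_ge0 B).
exists B'.+1, M'.+1; split=> // w j.
have B0 : 0 <= B by have := h [::] j; rewrite expr0 !mulr1; apply: le_trans.
rewrite ger0_norm // in hB.
apply: le_trans (h w j) _; rewrite !natrM natrX.
apply: ler_pM => //; first by rewrite mulr_ge0 // exprn_ge0 // ltW.
apply: ler_pM => //; first by rewrite exprn_ge0 // ltW.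
  by rewrite (le_trans hB) // ler_nat.
by apply: lerXn2r; rewrite ?nnegrE ?(ltW M0) // (le_trans hM) // ler_nat.
Qed.

Lemma wbound_LC M B c : 0 < M -> wbound M B c -> LC c.
Proof. by move=> M0 h; exists M; split => //; exists B. Qed.

Lemma LC_common c d : LC c -> LC d ->
  exists B M : nat, [/\ (0 < B)%N, (0 < M)%N, gbound B M c & gbound B M d].
Proof.
move=> /LCP[B [M [B0 M0 h]]] /LCP[B' [M' [B0' M0' h']]].
exists (B + B')%N, (M + M')%N; split; rewrite ?addn_gt0 ?B0 ?M0 //.
  by apply: gboundW h; apply: leq_addr.
by apply: gboundW h'; apply: leq_addl.
Qed.

Lemma LC_add c d : LC c -> LC d -> LC (sadd c d).
Proof.
move=> /LC_common h /h[B [M [B0 M0 hc hd]]]; apply/LCP.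
exists (B + B)%N, M; split; rewrite ?addn_gt0 ?B0 // => w j.
apply: le_trans (ler_normD _ _) _.
by rewrite !mulnDl natrD lerD.
Qed.

Lemma LC_scale (a : K) c : LC c -> LC (sscale a c).
Proof.
move=> /LCP[B [M [B0 M0 hc]]]; apply/LCP.
have [n hn] := archK (normr_ge0 a).
exists (n.+1 * B)%N, M; split; rewrite ?muln_gt0 // => w j.
rewrite normrM -!mulnA natrM mulnA ler_pM //.
by rewrite (le_trans hn) // ler_nat.
Qed.

Lemma ssubE c d : ssub c d = sadd c (sscale (-1) d).
Proof. by apply/funext => w; apply/funext => j; rewrite /ssub /sadd /sscale mulN1r. Qed.

Lemma LC_sub c d : LC c -> LC d -> LC (ssub c d).
Proof. by move=> hc hd; rewrite ssubE; apply: LC_add => //; apply: LC_scale. Qed.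

(** The growth bound is the Lipschitz estimate against the zero series in the first argument, with
    [eps = 1]. *)
Lemma LC_comp c d : LC c -> LC d -> LC (Defs.comp c d).
Proof.
move=> /LC_common h /h[B [M [B0 M0 hc hd]]]; apply/LCP.
exists B, (8 * M * (m.+1 * M * B))%N; split; rewrite ?muln_gt0 ?B0 ?M0 // => w j.
have z0 w' j' : Defs.comp (fun _ _ => 0) d w' j' = 0 :> K.
  by rewrite /Defs.comp big1 // => k _; rewrite big1 // => eta _; rewrite mul0r.
have := @comp_lipschitz K m (size w) M B 1 c (fun _ _ => 0) d d B0 M0 ler01.
rewrite -[Defs.comp c d w j]subr0 -[X in _ - X](z0 w j) -[X in _ -> _ <= X]mul1r; apply=> //.
- by move=> v i _; rewrite normr0.
- by move=> v i _; rewrite mul1r subr0.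
- by move=> v i _; rewrite subrr normr0 mulr_ge0.
Qed.

Definition level (n : nat) e : series K m := fun w j => if size w == n then e w j else 0.
Definition tail (n : nat) e : series K m := fun w j => if (n <= size w)%N then e w j else 0.

(** Measuring the part of degree [n] with radius [4 * M] gains [4 ^+ n]. Against a target of order
    [2 ^- n] this leaves [2 ^ n] to absorb constants. *)
Lemma level_bound p (M : nat) : silva_seminorm p -> (0 < M)%N ->
  exists C, 0 <= C /\ forall n f (a : K), 0 <= a ->
    (forall w j, size w = n -> `|f w j| <= a * (M ^ n * n`!)%:R) ->
    p (level n f) <= C * a / 4 ^+ n.
Proof.
move=> [_ hp] M0.
have M4 : 0 < (4 * M)%:R :> K by rewrite ltr0n muln_gt0.
have [C [C0 hC]] := hp _ M4.
exists C; split=> // n f a a0 hf; rewrite -mulrA.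
apply: hC => [|w j]; first by rewrite divr_ge0 // exprn_ge0.
rewrite /level; case: eqP => [e|_]; last first.
  by rewrite normr0 !mulr_ge0 ?invr_ge0 ?exprn_ge0.
apply: le_trans (hf w j e) _; rewrite e.
rewrite !natrM natrX exprMn.
by rewrite !mulrA divfK // expf_neq0 // pnatr_eq0.
Qed.

Lemma tail_small p e (eps : K) : silva_seminorm p -> LC e -> 0 < eps ->
  exists N, p (tail N e) <= eps.
Proof.
move=> [_ hp] /LCP[B [M [B0 M0 he]]] eps0.
have M2 : 0 < (2 * M)%:R :> K by rewrite ltr0n muln_gt0.
have [C [C0 hC]] := hp _ M2.
have [|N hN] := archK (x := C * B%:R / eps); first by rewrite divr_ge0 ?mulr_ge0 // ltW.
exists N.
have pN : 0 < 2 ^+ N :> K by rewrite exprn_gt0.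
apply: le_trans (hC _ (B%:R / 2 ^+ N) _ _) _; first by rewrite divr_ge0 // ltW.
  move=> w j; rewrite /tail; case: ifP => [lN|_]; last first.
    by rewrite normr0 !mulr_ge0 ?invr_ge0 ?exprn_ge0.
  apply: le_trans (he w j) _.
  rewrite !natrM natrX exprMn; apply: ler_wpM2r => //.
  have -> : B%:R / 2 ^+ N * (2 ^+ size w * M%:R ^+ size w) =
    B%:R * M%:R ^+ size w * (2 ^+ size w / 2 ^+ N) :> K by ring.
  rewrite ler_peMr // ?mulr_ge0 ?exprn_ge0 //.
  by rewrite ler_pdivlMr // mul1r ler_weXn2l // ler1n.
rewrite mulrA ler_pdivrMr // [eps * _]mulrC -ler_pdivrMr //.
apply: le_trans hN _; rewrite -natrX ler_nat.
exact: ltnW (ltn_expl _ _).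
Qed.

Lemma small_by_levels p e (eps : K) : silva_seminorm p -> LC e -> 0 < eps ->
  (forall n, p (level n e) <= eps / 2 ^+ n.+2) -> p e < eps.
Proof.
move=> sp he eps0 hl.
have [[p0 [pD _]] _] := sp.
have LCtail N : LC (tail N e).
  have /LCP[B [M [B0 M0 h]]] := he; apply/LCP; exists B, M; split=> // w j.
  by rewrite /tail; case: ifP => // _; rewrite normr0.
have LClevel N : LC (level N e).
  have /LCP[B [M [B0 M0 h]]] := he; apply/LCP; exists B, M; split=> // w j.
  by rewrite /level; case: ifP => // _; rewrite normr0.
have split_tail N : tail N e = sadd (level N e) (tail N.+1 e).
  apply/funext => w; apply/funext => j; rewrite /tail /sadd /level.
  by case: ltngtP => _; rewrite ?addr0 ?add0r.
(* The subtracted form is the closed form of the sum of [eps / 2 ^+ n.+2] over [n < N]. *)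
have acc N : p e <= eps / 2 - eps / 2 ^+ N.+1 + p (tail N e).
  elim: N => [|N IH]; first by rewrite subrr add0r.
  apply: le_trans IH _; rewrite split_tail.
  apply: le_trans (lerD (lexx _) (pD _ _ (LClevel _) (LCtail _))) _.
  rewrite addrA lerD2r.
  apply: le_trans (lerD (lexx _) (hl N)) _.
  rewrite le_eqVlt; apply/orP; left; apply/eqP.
  by rewrite !exprS; field; rewrite ?expf_neq0 ?pnatr_eq0.
have e2 : 0 < eps / 2 by rewrite divr_gt0.
have [N hN] := tail_small sp he e2.
apply: le_lt_trans (acc N) _.
apply: (@lt_le_trans _ _ (eps / 2 + eps / 2)).
  by apply: ltr_leD hN; rewrite gtrBl divr_gt0 // exprn_gt0.
by rewrite -splitr.
Qed.

(** In high degree the gain from [level_bound] beats any fixed constant [D], so no closeness of the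
    series is required there. *)
Lemma level_threshold p (M D : nat) (eps : K) : silva_seminorm p -> (0 < M)%N -> 0 < eps ->
  exists n0, forall n f, (n0 <= n)%N ->
    (forall w j, size w = n -> `|f w j| <= (D * M ^ n * n`!)%:R) ->
    p (level n f) <= eps / 2 ^+ n.+2.
Proof.
move=> sp M0 eps0; have [C [C0 hC]] := level_bound sp M0.
have [|n0 hn0] := archK (x := C * D%:R * 4 / eps); first by rewrite divr_ge0 ?mulr_ge0 // ltW.
exists n0 => n f ln hf.
apply: le_trans (hC n f D%:R _ _) _ => //.
  by move=> w j e; rewrite -natrM mulnA hf.
have hn : C * D%:R * 4 / eps <= 2 ^+ n.
  apply: le_trans hn0 _; rewrite -natrX ler_nat (leq_trans ln) //.
  exact: ltnW (ltn_expl _ _).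
rewrite ler_pdivrMr // in hn.
rewrite ler_pdivrMr ?exprn_gt0 //.
have -> : eps / 2 ^+ n.+2 * 4 ^+ n = 2 ^+ n * eps / 4.
  rewrite (_ : 4 = 2 * 2) ?exprMn; last by rewrite -natrM.
  by rewrite !exprS; field; rewrite ?expf_neq0 ?pnatr_eq0.
by rewrite ler_pdivlMr.
Qed.

(** [q] is the weighted sup norm. Since [r] is unbounded, its weights dominate every [M ^ n] up to a
    constant, which makes [q] finite on all of [LC] and bounded on each l_{infty,M}. *)
Lemma weighted_seminorm (r : nat -> nat) : (forall n, (0 < r n)%N) ->
    (forall R, exists n0, forall n, (n0 <= n)%N -> (R <= r n)%N) ->
  exists q, silva_seminorm q /\ forall c, LC c ->
    forall w j, `|c w j| <= q c * (r (size w) ^ size w * (size w)`!)%:R.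
Proof.
move=> r0 roo.
pose W w : K := (r (size w) ^ size w * (size w)`!)%:R.
have W0 w : 0 < W w by rewrite ltr0n muln_gt0 fact_gt0 expn_gt0 r0.
have dom (M : nat) : exists D : nat, forall n, (M ^ n <= D * r n ^ n)%N.
  (* The constant covers the degrees below [n0]; from [n0] on, [M <= r n] suffices. The successor
     keeps the base positive. *)
  have [n0 h] := roo M; exists (M.+1 ^ n0)%N => n.
  have [/h le|/ltnW lt] := leqP n0 n.
    by apply: leq_trans (leq_pmull _ _); rewrite ?expn_gt0 // leq_wexp2r.
  apply: leq_trans (leq_pmulr _ _); rewrite ?expn_gt0 ?r0 //.
  apply: (@leq_trans (M.+1 ^ n)); first by rewrite leq_wexp2r.
  by rewrite leq_pexp2l.
have lub c : exists s, LC c -> [/\ 0 <= s, forall w j, `|c w j| <= s * W w &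
    forall b, 0 <= b -> (forall w j, `|c w j| <= b * W w) -> s <= b].
  have [hc|] := pselect (LC c); last by exists 0.
  have /LCP[B [M [B0 M0 h]]] := hc.
  have [D hD] := dom M.
  (* Adjoining 0 keeps the set inhabited even when [m = 0]. *)
  have [|x|s [ub lb]] := @lubK (fun x => x = 0 \/ exists w j, x = `|c w j| / W w) (B * D)%:R.
  - by left.
  - case=> [->|[w [j ->]]]; first by rewrite lexx /=.
    rewrite divr_ge0 ?(ltW (W0 _)) //=; rewrite ler_pdivrMr //.
    apply: le_trans (h w j) _; rewrite -natrM ler_nat mulnA leq_mul // -mulnA leq_mul //.
  - exists s => _; split.
    + by apply: ub; left.
    + by move=> w j; rewrite -ler_pdivrMr //; apply: ub; right; exists w, j.
    + move=> b b0 hb; apply: lb => x [->//|[w [j ->]]].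
      by rewrite ler_pdivrMr.
have [q hq] := choice lub.
have q_scale a c : LC c -> q (sscale a c) <= `|a| * q c.
  move=> hc; have [_ _] := hq _ (LC_scale a hc); apply.
    by rewrite mulr_ge0 //; case: (hq _ hc).
  by move=> w j; rewrite normrM -mulrA ler_wpM2l //; case: (hq _ hc).
exists q; split; last by move=> c /hq[].
split; first split; [|split|].
- by move=> c /hq[].
- move=> c d hc hd; have [_ _] := hq _ (LC_add hc hd); apply.
    by rewrite addr_ge0 //; [case: (hq _ hc) | case: (hq _ hd)].
  move=> w j; apply: le_trans (ler_normD _ _) _; rewrite mulrDl lerD //.
    by case: (hq _ hc).
  by case: (hq _ hd).
- move=> a c hc; apply: le_anti; rewrite q_scale //=.
  have [->|a0] := eqVneq a 0.
    by rewrite normr0 mul0r; case: (hq _ (LC_scale 0 hc)).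
  have na : 0 < `|a| by rewrite normr_gt0.
  (* The reverse inequality is [q_scale] for the inverse scalar. *)
  have := q_scale a^-1 _ (LC_scale a hc).
  have -> : sscale a^-1 (sscale a c) = c.
    by apply/funext => w; apply/funext => j; rewrite /sscale mulKf.
  by rewrite normfV mulrC ler_pdivlMr // mulrC.
- move=> M M0; have [M' hM] := archK (ltW M0); have [D hD] := dom M'.
  exists D%:R; split=> // c B B0 h.
  have [_ _] := hq _ (wbound_LC M0 h); apply; first by rewrite mulr_ge0.
  move=> w j; apply: le_trans (h w j) _.
  rewrite /W natrM mulrA ler_wpM2r // [D%:R * B]mulrC -mulrA ler_wpM2l //.
  rewrite -natrM; apply: (@le_trans _ _ (M' ^ size w)%:R); last by rewrite ler_nat.
  by rewrite natrX; apply: lerXn2r => //; rewrite ?nnegrE ?(ltW M0).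
Qed.

Lemma seminorm_ball_open q c0 (eps : K) : silva_seminorm q -> LC c0 ->
  silva_open (fun c => LC c /\ q (ssub c c0) < eps).
Proof.
move=> sq hc0; split=> [c []//|c [hc lt]].
exists q; split=> //; exists (eps - q (ssub c c0)); split; first by rewrite subr_gt0.
move=> d hd; rewrite ltrBrDr => {}lt; split=> //; apply: le_lt_trans lt.
have -> : ssub d c0 = sadd (ssub d c) (ssub c c0).
  by apply/funext => w; apply/funext => j; rewrite /sadd /ssub addrA subrK.
by case: sq => -[_ [qD _]] _; apply: qD; apply: LC_sub.
Qed.

Lemma seminorm_subrr q c : silva_seminorm q -> LC c -> q (ssub c c) = 0.
Proof.
move=> [[_ [_ qZ]] _] hc.
have -> : ssub c c = sscale 0 c.
  by apply/funext => w; apply/funext => j; rewrite /sscale /ssub mul0r subrr.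
by rewrite qZ // normr0 mul0r.
Qed.

Lemma comp_continuous : comp_silva_continuous K m.
Proof.
split=> [|U [UL Uo]]; first exact: LC_comp.
split=> [c d [hc [hd _]] //|c0 d0 [hc0 [hd0 /Uo[p [sp [eps [eps0 hU]]]]]]].
have [B [M [B0 M0 bc bd]]] := LC_common hc0 hd0.
(* G R is the geometric rate that [comp_lipschitz] produces for the radius M + R. *)
pose G R := (8 * (M + R) * (m.+1 * (M + R) * B.+1))%N.
have MR R : (0 < M + R)%N by rewrite addn_gt0 M0.
have G0 R : (0 < G R)%N by rewrite !muln_gt0 MR.
(* From degree [thr R] on, a level bounded at rate [G R] is small enough whatever [delta] is; [r]
   takes a value [R > 1] only there. *)
have [thr hthr] := choice (fun R => level_threshold B.+1 sp (G0 R) eps0).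
have [r [r0 rmono roo rthr]] := slow_growth thr.
have [q [sq hq]] := weighted_seminorm r0 roo.
(* The degrees where [r] is still 1 may lie below the thresholds; [delta] is chosen to make these
   levels small. *)
have [C [C0 hC]] := level_bound sp (G0 1%N).
have [|k hk] := archK (x := C * B.+1%:R * 4 / eps).
  by rewrite divr_ge0 ?mulr_ge0 // ltW.
pose delta : K := k.+1%:R^-1.
have dl0 : 0 < delta by rewrite invr_gt0 ltr0n.
have dl1 : delta <= 1 by rewrite invf_le1 ?ler1n ?ltr0n.
exists (fun c => LC c /\ q (ssub c c0) < delta), (fun d => LC d /\ q (ssub d d0) < delta).
do 2 (split; first exact: seminorm_ball_open).
split; first by rewrite seminorm_subrr.
split; first by rewrite seminorm_subrr.
move=> c d [hc qc] [hd qd]; split=> //; split=> //.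
have LCcd := LC_comp hc hd; have LCcd0 := LC_comp hc0 hd0.
apply: hU => //; apply: small_by_levels => //; first exact: LC_sub.
move=> n.
(* Monotonicity of [r] replaces the varying radius by [r n] on all words of length at most [n]. *)
have near e e0 : LC e -> LC e0 -> q (ssub e e0) < delta -> forall w j, (size w <= n)%N ->
    `|e w j - e0 w j| <= delta * (r n ^ size w * (size w)`!)%:R.
  move=> he he0 lt w j lw; apply: le_trans (hq _ (LC_sub he he0) w j) _.
  apply: ler_pM => //; [by case: sq => -[q0 _] _; apply/q0/LC_sub | exact: ltW |].
  by rewrite ler_nat leq_mul // leq_wexp2r // rmono.
have bnd w j : size w = n -> `|ssub (Defs.comp c d) (Defs.comp c0 d0) w j| <=
    delta * (B.+1 * G (r n) ^ n * n`!)%:R.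
  move=> sw; rewrite -sw; apply: (@comp_lipschitz _ _ n); rewrite ?sw ?MR //.
  - exact: ltW.
  - by move=> v i _; apply: (gboundW _ _ bc); rewrite ?leq_addr.
  (* The constant [B.+1] is [B] for [d0] plus 1 for the difference, as [delta <= 1]. *)
  - move=> v i lv; rewrite -[d v i](subrK (d0 v i)).
    apply: le_trans (ler_normD _ _) _.
    rewrite mulSn mulnDl natrD lerD //.
      apply: le_trans (near _ _ hd hd0 qd _ _ lv) _.
      apply: le_trans (ler_wpM2r _ dl1) _ => //; rewrite mul1r ler_nat leq_mul //.
      by rewrite leq_wexp2r // leq_addl.
    by apply: (gboundW _ _ bd); rewrite ?leq_addr.
  - by move=> v i _; apply: (gboundW _ _ bd); rewrite ?leq_addr.
  - move=> v i lv; apply: le_trans (near _ _ hc hc0 qc _ _ lv) _.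
    rewrite ler_wpM2l ?(ltW dl0) // ler_nat leq_mul //.
    by apply: leq_trans (leq_pmull _ _) => //; rewrite leq_wexp2r // leq_addl.
  - move=> v i lv; apply: le_trans (near _ _ hd hd0 qd _ _ lv) _.
    rewrite ler_wpM2l ?(ltW dl0) // ler_nat leq_mul //.
    by apply: leq_trans (leq_pmull _ _) => //; rewrite leq_wexp2r // leq_addl.
have [r1|rn] := rthr n; last first.
  apply: hthr rn _ => w j sw; apply: le_trans (bnd w j sw) _.
  by rewrite ler_piMl.
apply: le_trans (hC n _ (delta * B.+1%:R) _ _) _.
- by rewrite mulr_ge0 // ltW.
- by move=> w j sw; rewrite -r1 -mulrA -natrM mulnA bnd.
have {}hk : C * (delta * B.+1%:R) * 4 <= eps.
  have -> : C * (delta * B.+1%:R) * 4 = C * B.+1%:R * 4 / k.+1%:R by rewrite /delta; ring.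
  rewrite ler_pdivrMr ?ltr0n // [eps * _]mulrC -ler_pdivrMr //.
  by apply: le_trans hk _; rewrite ler_nat.
rewrite ler_pdivlMr ?exprn_gt0 //.
apply: le_trans hk.
rewrite -[leLHS]mulrA; apply: ler_wpM2l; first by rewrite !mulr_ge0 ?(ltW dl0).
rewrite mulrC ler_pdivrMr ?exprn_gt0 // -!natrX -natrM ler_nat.
by rewrite -(addn2 n) expnD mulnC leq_mul // leq_wexp2r.
Qed.

End Silva.

(** * The order properties for real and complex scalars *)

Lemma realType_arch (R : realType) (x : R) : (0 <= x)%R -> exists n : nat, (x <= n%:R)%R.
Proof. by move=> x0; exists (Num.bound x); apply/ltW/archi_boundP. Qed.

Lemma realType_lub (R : realType) (A : R -> Prop) (b : R) : A 0%R ->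
  (forall x, A x -> (0 <= x <= b)%R) ->
  exists s, (forall x, A x -> (x <= s)%R) /\
    forall b', (forall x, A x -> (x <= b')%R) -> (s <= b')%R.
Proof.
move=> A0 hA; exists (sup A); split=> [x Ax|b' hb'].
  by apply: ub_le_sup => //; exists b => y /hA/andP[].
by apply: ge_sup => //; exists 0%R.
Qed.

Lemma complex_ge0 (R : realType) (x : R[i]) : (0 <= x)%R ->
  x = (complex.Re x)%:C%C /\ (0 <= complex.Re x)%R.
Proof. by case: x => a b; rewrite lecE /= => /andP[/eqP -> ->]. Qed.

Lemma complex_arch (R : realType) (x : R[i]) : (0 <= x)%R -> exists n : nat, (x <= n%:R)%R.
Proof.
move=> /complex_ge0[-> /realType_arch[n hn]]; exists n.
by rewrite -(rmorph_nat (real_complex R)) lecR.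
Qed.

(** All members of [A] are nonnegative, hence real, and so is every upper bound because [A] contains
    0; the real supremum therefore serves. *)
Lemma complex_lub (R : realType) (A : R[i] -> Prop) (b : R[i]) : A 0%R ->
  (forall x, A x -> (0 <= x <= b)%R) ->
  exists s, (forall x, A x -> (x <= s)%R) /\
    forall b', (forall x, A x -> (x <= b')%R) -> (s <= b')%R.
Proof.
move=> A0 hA.
have b0 : (0 <= b)%R by have /andP[] := hA _ A0.
have [eb _] := complex_ge0 b0.
have [||s [ub lb]] := @realType_lub R (fun x => A x%:C%C) (complex.Re b) => //.
  by move=> x /hA; rewrite {1}eb !lecR.
exists s%:C%C; split=> [x Ax|b' hb'].
  have /andP[/complex_ge0[ex _] _] := hA _ Ax.
  by rewrite ex lecR; apply: ub; rewrite -ex.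
have [eb' _] := complex_ge0 (hb' _ A0).
by rewrite eb' lecR; apply: lb => x /hb'; rewrite {1}eb' lecR.
Qed.

(* K in {R, C}: R is any real-number model (realType), C = R[i]. *)
Theorem theorem3p8 (R : realType) (m : nat) :
  comp_silva_continuous R m /\ comp_silva_continuous R[i] m.
Proof.
split; apply: comp_continuous.
- exact: realType_arch.
- exact: realType_lub.
- exact: complex_arch.
- exact: complex_lub.
Qed.
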